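(* Let $p_0,p_1,q_0,q_1,r\in(0,\infty]$, let $F$ and $G$ be real vector spaces, let $A_k:F\to L^{p_k}$ and $B_k:G\to L^{q_k}$ ($k=0,1$) be linear operators, and let $\tau:F\times G\to L^r$ be a bilinear operator for which there is a constant $C$ such that $$\|\tau(f,g)\|_{L^r}\le C\big(\|A_0f\|_{L^{p_0}}\|B_0g\|_{L^{q_0}}+\|A_1f\|_{L^{p_1}}\|B_1g\|_{L^{q_1}}\big)\qquad\text{for all } f\in F,\ g\in G.$$ Let $n\ge 1$. Then there is a constant $C'$, depending only on $n$, $C$ and the exponents $p_0,p_1,q_0,q_1,r$, such that for all $\vec f=(f_1,\dots,f_n)\in F^n$ and $\vec g=(g_1,\dots,g_n)\in G^n$ the vector-valued extension $\tau(\vec f,\vec g):=\sum_{i=1}^n\tau(f_i,g_i)$ satisfies $$\|\tau(\vec f,\vec g)\|_{L^r}\le C'\sum_{k=0}^1\big\|(x,y)\mapsto A_k\vec f(x)\cdot B_k\vec g(y)\big\|_{L^{p_k}_x(L^{q_k}_y)},$$ and the same is true for each of the bounds in which, for either one or both of $k=0,1$, the norm $L^{p_k}_x(L^{q_k}_y)$ on the right is replaced by $L^{q_k}_y(L^{p_k}_x)$.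
   Context: The spaces $L^{p_k}$, $L^{q_k}$, $L^r$ are real Lebesgue spaces over (possibly different) measure spaces; for exponents in $(0,1)$ the usual expression $\|f\|_{L^p}=(\int|f|^p)^{1/p}$ is a quasi-norm. $A_k\vec f:=(A_kf_1,\dots,A_kf_n)$ and $B_k\vec g:=(B_kg_1,\dots,B_kg_n)$ are regarded as $\mathbb R^n$-valued functions, and $A_k\vec f(x)\cdot B_k\vec g(y)=\sum_{i=1}^n A_kf_i(x)\,B_kg_i(y)$. The iterated norms are $\|h\|_{L^p_x(L^q_y)}=\big\|x\mapsto\|h(x,\cdot)\|_{L^q}\big\|_{L^p}$ and $\|h\|_{L^q_y(L^p_x)}=\big\|y\mapsto\|h(\cdot,y)\|_{L^p}\big\|_{L^q}$. *)

(* Defs.v *)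
From HB Require Import structures.
From mathcomp Require Import all_boot all_order all_algebra.
From mathcomp Require Import all_classical all_reals all_analysis.

Set Implicit Arguments.
Unset Strict Implicit.
Unset Printing Implicit Defensive.
Import Order.TTheory GRing.Theory Num.Theory.
Import numFieldNormedType.Exports.
Local Open Scope classical_set_scope.
Local Open Scope ring_scope.

(* MathComp-Analysis has no vector space structure on the quotient L^p, and its
   LspaceType requires 1 <= p. A linear operator F -> L^p is therefore given by
   a choice of representatives: A f : T -> R is measurable with finite L^p
   (quasi-)norm, and linearity holds almost everywhere, i.e. in the quotient. *)

Definition Lp_valued_linear (R : realType) (F : lmodType R)
    (d : measure_display) (T : measurableType d)
    (mu : {measure set T -> \bar R}) (p : \bar R) (A : F -> T -> R) : Prop :=
  (forall f : F, A f \in Lfun mu p) /\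
  (forall (a : R) (f1 f2 : F),
    \forall t \ae mu, A (a *: f1 + f2) t = a * A f1 t + A f2 t).

Definition Lp_valued_bilinear (R : realType) (F G : lmodType R)
    (d : measure_display) (T : measurableType d)
    (mu : {measure set T -> \bar R}) (p : \bar R) (tau : F -> G -> T -> R) :
    Prop :=
  (forall g : G, Lp_valued_linear mu p (fun f : F => tau f g)) /\
  (forall f : F, Lp_valued_linear mu p (tau f)).

Definition mixed_norm_xy (R : realType) (dX dY : measure_display)
    (X : measurableType dX) (Y : measurableType dY)
    (mu : {measure set X -> \bar R}) (nu : {measure set Y -> \bar R})
    (p q : \bar R) (h : X -> Y -> R) : \bar R :=
  ('N[mu]_p[(fun x : X => 'N[nu]_q[(fun y : Y => (h x y)%:E)])])%E.

Definition mixed_norm_yx (R : realType) (dX dY : measure_display)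
    (X : measurableType dX) (Y : measurableType dY)
    (mu : {measure set X -> \bar R}) (nu : {measure set Y -> \bar R})
    (p q : \bar R) (h : X -> Y -> R) : \bar R :=
  ('N[nu]_q[(fun y : Y => 'N[mu]_p[(fun x : X => (h x y)%:E)])])%E.

Definition mixed_norm (R : realType) (dX dY : measure_display)
    (X : measurableType dX) (Y : measurableType dY)
    (mu : {measure set X -> \bar R}) (nu : {measure set Y -> \bar R})
    (p q : \bar R) (swap : bool) (h : X -> Y -> R) : \bar R :=
  if swap then mixed_norm_yx mu nu p q h else mixed_norm_xy mu nu p q h.

Definition dot_product (R : realType) (X Y : Type) (F G : Type) (n : nat)
    (A : F -> X -> R) (B : G -> Y -> R) (f : 'I_n -> F) (g : 'I_n -> G) :
    X -> Y -> R :=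
  fun x y => \sum_(i < n) A (f i) x * B (g i) y.

(* Main.v *)
Require Import Defs.
From HB Require Import structures.
From mathcomp Require Import all_boot all_order all_algebra.
From mathcomp Require Import all_classical all_reals all_analysis.
From mathcomp Require Import measurable_realfun ess_sup_inf lra.

Set Implicit Arguments.
Unset Strict Implicit.
Unset Printing Implicit Defensive.
Import Order.TTheory GRing.Theory Num.Theory.
Import numFieldNormedType.Exports.
Local Open Scope classical_set_scope.
Local Open Scope ring_scope.

(* The sum of the tau (f_i, g_i) and the dot products of the A_k f_i with the
   B_k g_i do not change when f is replaced by its image f' under an invertible
   matrix M and g by its image g' under the contragredient of M. Since tau (f, g)
   is a sum of n terms, it thus suffices to find M such that, for k = 0, 1 and
   every j, the product |A_k f'_j| |B_k g'_j| is controlled by the mixed norm.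

   The maps c |-> |A_k (sum_i c_i f_i)| are two quasi-seminorms on R^n. They have
   a common "adapted" basis M, i.e. one in which each of them dominates its
   restrictions to the coordinate axes (the analogue of the simultaneous
   diagonalization of two quadratic forms): its first vector nearly maximizes the
   ratio of the two quasi-seminorms, so a nearly norming functional for one of
   them is nearly norming for the other, and one recurses into its kernel.

   If the inner norm is taken in x, adaptedness bounds it from below at each y by
   |A_k f'_j| |B_k g'_j (y)|. If it is taken in y, the same argument is applied to
   a basis adapted to c |-> |B_k (sum_i c_i g_i)|, and the resulting bounds are
   converted by expanding that basis in the one dual to M. *)

(** * Adapted bases of quasi-seminorms *)

Definition quasi_seminorm (R : realType) (V : lmodType R) (k : R) (a : V -> R) :
    Prop :=
  [/\ forall x, 0 <= a x,
      forall c x, a (c *: x) = `|c| * a x &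
      forall x y, a (x + y) <= k * (a x + a y)].

(** For a norm, [K] = 1 and an invertible [M], the rows of [M] form an Auerbach basis. The
    multiplied-out form allows [a] to vanish on rows. *)
Definition adapted (R : realType) (n : nat) (K : R) (a : 'rV[R]_n -> R)
    (M : 'M[R]_n) : Prop :=
  forall (c : 'rV[R]_n) (j : 'I_n), `|c 0 j| * a (row j M) <= K * a (c *m M).

Section QuasiSeminorms.
Variable R : realType.

Lemma quasi_seminorm0 (V : lmodType R) (k : R) (a : V -> R) :
  quasi_seminorm k a -> a 0 = 0.
Proof. by case=> _ aZ _; rewrite -(scale0r 0) aZ normr0 mul0r. Qed.

Lemma quasi_seminorm_comp (V W : lmodType R) (k : R) (a : W -> R)
    (h : {linear V -> W}) :
  quasi_seminorm k a -> quasi_seminorm k (a \o h).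
Proof.
case=> a0 aZ aD; split=> [x|c x|x y] /=; first exact: a0.
  by rewrite linearZ aZ.
by rewrite linearD.
Qed.

Lemma quasi_seminorm_sum (V : lmodType R) (k : R) (a : V -> R) (n : nat)
    (x : 'I_n -> V) :
  1 <= k -> quasi_seminorm k a ->
  a (\sum_(i < n) x i) <= k ^+ n * \sum_(i < n) a (x i).
Proof.
move=> k1 qa; have [a0 _ aD] := qa; have k0 : 0 <= k by lra.
elim: n x => [|n IHn] x; first by rewrite !big_ord0 mulr0 (quasi_seminorm0 qa).
rewrite !big_ord_recr /= (le_trans (aD _ _))// exprS -mulrA ler_wpM2l//.
rewrite mulrDr lerD ?IHn// ler_peMl// exprn_ege1//.
Qed.

Lemma quasi_seminorm_mulmx (n : nat) (k : R) (a : 'rV[R]_n -> R) (c : 'rV[R]_n)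
    (M : 'M[R]_n) :
  1 <= k -> quasi_seminorm k a ->
  a (c *m M) <= k ^+ n * \sum_(i < n) `|c 0 i| * a (row i M).
Proof.
move=> k1 qa; rewrite mulmx_sum_row (le_trans (quasi_seminorm_sum _ k1 qa))//.
by under eq_bigr do rewrite (let: And3 _ aZ _ := qa in aZ).
Qed.

(* Helly's theorem on the line: pairwise intersecting intervals
   [d v - r v, d v + r v] have a common point. *)
Lemma common_point (T : Type) (t0 : T) (d r : T -> R) :
  (forall v w, d v - d w <= r v + r w) ->
  exists l, forall v, `|d v - l| <= r v.
Proof.
move=> dr; pose S := [set d v - r v | v in [set: T]].
have ubS w : ubound S (d w + r w).
  by move=> _ [v _ <-]; have := dr v w; lra.
have supS : has_sup S.
  by split; [exists (d t0 - r t0), t0 | exists (d t0 + r t0)].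
exists (sup S) => v; rewrite ler_distlC; apply/andP; split.
  by apply: ub_le_sup; [exact: supS.2 | exists v].
by rewrite addrC; apply: ge_sup; [exact: supS.1 | rewrite addrC].
Qed.

Lemma mul_col_mx_row1 (m n : nat) (c : 'rV[R]_(1 + n)) (w : 'rV[R]_m)
    (Q : 'M[R]_(n, m)) :
  c *m col_mx w Q = c 0 (lshift n 0) *: w + rsubmx c *m Q.
Proof.
rewrite -{1}(hsubmxK c) mul_row_col; congr (_ + _).
by rewrite [lsubmx c]mx11_scalar mul_scalar_mx mxE.
Qed.

(** The component in the span of [Q] is the whole vector minus [t *: w], and the latter is at most
    [K1] times the whole. The quasi-triangle inequality thus costs [k * (1 + K1)], and adaptedness
    of [M] a further [K]. *)
Lemma adapted_step (n : nat) (k K1 K : R) (a : 'rV[R]_(1 + n) -> R)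
    (w : 'rV[R]_(1 + n)) (Q : 'M[R]_(n, 1 + n)) (M : 'M[R]_n) :
  0 <= k -> 0 <= K -> quasi_seminorm k a ->
  (forall t v, `|t| * a w <= K1 * a (t *: w + v *m Q)) ->
  adapted K (fun v => a (v *m Q)) M ->
  adapted (K1 + K * k * (1 + K1)) a (col_mx w (M *m Q)).
Proof.
move=> k0 K0 [a0 aZ aD] hw hM c j; rewrite mul_col_mx_row1 mulmxA.
set t := c 0 (lshift n 0); set v := rsubmx c; set A := a (_ + _).
have A0 : 0 <= A by exact: a0.
have head : `|t| * a w <= K1 * A by exact: hw.
have K1A : 0 <= K1 * A by rewrite (le_trans _ head)// mulr_ge0.
have KA : 0 <= K * k * (1 + K1) * A.
  by rewrite -!mulrA mulr_ge0// mulr_ge0// mulrDl mul1r addr_ge0.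
rewrite mulrDl; case: (split_ordP j) => i ->.
  by rewrite rowKu [i]ord1 row_id (le_trans head)// lerDl.
rewrite rowKd -[leLHS]add0r lerD// row_mul.
have -> : c 0 (rshift 1 i) = v 0 i by rewrite mxE.
rewrite (le_trans (hM v i))// -!mulrA ler_wpM2l//.
have -> : v *m M *m Q = (t *: w + v *m M *m Q) + (- t) *: w.
  by rewrite scaleNr addrAC subrr add0r.
by rewrite (le_trans (aD _ _))// ler_wpM2l// aZ normrN mulrDl mul1r lerD2l.
Qed.

Lemma unitmx_col_mx (n : nat) (w : 'rV[R]_(1 + n)) (Q : 'M[R]_(n, 1 + n))
    (M : 'M[R]_n) :
  M \in unitmx -> (col_mx w Q : 'M[R]_(1 + n)) \in unitmx ->
  (col_mx w (M *m Q) : 'M[R]_(1 + n)) \in unitmx.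
Proof.
move=> uM uQ; suff -> : col_mx w (M *m Q) =
    (block_mx 1%:M 0 0 M : 'M[R]_(1 + n)) *m col_mx w Q.
  by rewrite unitmx_mul uQ andbT unitmxE det_ublock det1 mul1r -unitmxE.
by rewrite block_mxEv mul_col_mx !mul_row_col !mul0mx mul1mx addr0 add0r.
Qed.

(* The complement [w] of the hyperplane of the last [n] coordinates is found as
   in the Hahn-Banach theorem, one coordinate (of an adapted basis of the
   hyperplane) at a time; this nearly minimizes [a] on the affine hyperplane. *)
Lemma complement_vector (n : nat) (k K : R) (a : 'rV[R]_(1 + n) -> R)
    (M : 'M[R]_n) :
  1 <= k -> 0 <= K -> quasi_seminorm k a -> M \in unitmx ->
  adapted K (fun v => a (row_mx 0 v)) M ->
  exists l : 'rV[R]_n, forall v,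
    a (row_mx 1%:M l) <=
    k * (1 + k ^+ n * (n%:R * (K * k))) * a (row_mx 1%:M v).
Proof.
move=> k1 K0 qa uM hM; have k0 : 0 <= k by lra.
pose a' := fun v : 'rV[R]_n => a (row_mx 0 v).
have qa' : quasi_seminorm k a'.
  split=> [x|c x|x y]; rewrite /a'; first by case: qa.
    by case: qa => _ aZ _; rewrite -aZ scale_row_mx scaler0.
  by case: qa => _ _ aD; rewrite -{1}(addr0 0) -add_row_mx.
have [a0 aZ aD] := qa.
pose d (v : 'rV[R]_n) := v *m invmx M.
pose rho v := K * k * a (row_mx 1%:M v).
have rho0 v : 0 <= rho v by rewrite !mulr_ge0.
have rowB v v' : row_mx 0 (v - v') = row_mx 1%:M v + (-1) *: row_mx 1%:M v'
    :> 'rV[R]_(1 + n).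
  by rewrite scale_row_mx add_row_mx !scaleN1r subrr.
(* [row_mx 0 (v - v')] is a difference of two points of the affine hyperplane; this gives the
   pairwise condition of [common_point] in each coordinate. *)
have dB j v v' : `|d v 0 j - d v' 0 j| * a' (row j M) <= rho v + rho v'.
  have <- : d (v - v') 0 j = d v 0 j - d v' 0 j by rewrite /d mulmxBl !mxE.
  rewrite (le_trans (hM (d (v - v')) j))// mulmxKV//.
  rewrite rowB /rho -mulrDr -!mulrA ler_wpM2l// (le_trans (aD _ _))//.
  by rewrite aZ normrN1 mul1r.
have /choice[l hl] j :
    exists l, forall v, `|d v 0 j - l| * a' (row j M) <= rho v.
  have [->|A0] := eqVneq (a' (row j M)) 0.
    by exists 0 => v; rewrite mulr0.
  have {}A0 : 0 < a' (row j M) by rewrite lt0r A0 /=; exact: a0.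
  have [|l hl] := @common_point 'rV[R]_n 0 (fun v => d v 0 j)
      (fun v => rho v / a' (row j M)).
    move=> v v'; rewrite -mulrDl ler_pdivlMr// (le_trans _ (dB j v v'))//.
    by rewrite ler_wpM2r ?ler_norm// ltW.
  by exists l => v; rewrite -ler_pdivlMr.
(* The difference from [row_mx 1%:M v] lies in the linear hyperplane and has coordinates
   [l j - d v 0 j] in the basis [M], each contributing at most [rho v]. *)
exists ((\row_j l j) *m M) => v.
have -> : row_mx 1%:M (\row_j l j *m M) =
    row_mx 1%:M v + row_mx 0 ((\row_j l j - d v) *m M).
  by rewrite add_row_mx addr0 mulmxBl mulmxKV// subrKC.
rewrite (le_trans (aD _ _))// -mulrA ler_wpM2l// mulrDl mul1r lerD2l.
have := quasi_seminorm_mulmx (\row_j l j - d v) M k1 qa'.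
move=> /le_trans -> //; rewrite -mulrA ler_wpM2l ?exprn_ge0//.
rewrite -mulrA (le_trans (ler_sum _ (G := fun=> rho v) _))//.
  move=> j _; have -> : (\row_j l j - d v) 0 j = l j - d v 0 j by rewrite !mxE.
  by rewrite distrC; exact: hl.
by rewrite sumr_const card_ord mulr_natl.
Qed.

(** Induction on the dimension, with [complement_vector] supplying the first row. [K] is chosen
    before [a]; this uniformity passes on to the constant of the theorem. *)
Lemma adapted_basis (n : nat) (k : R) : 1 <= k ->
  exists2 K : R, 0 <= K & forall a : 'rV[R]_n -> R, quasi_seminorm k a ->
    exists2 M : 'M[R]_n, M \in unitmx & adapted K a M.
Proof.
move=> k1; have k0 : 0 <= k by lra.
elim: n => [|n [K K0 IH]].
  by exists 0 => // a _; exists 1%:M; [exact: unitmx1 | move=> c []].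
pose K1 := k * (1 + k ^+ n * (n%:R * (K * k))).
have K10 : 0 <= K1 by rewrite !(mulr_ge0, addr_ge0) ?exprn_ge0.
exists (K1 + K * k * (1 + K1)).
  by rewrite addr_ge0// !mulr_ge0// addr_ge0.
rewrite -[n.+1]/(1 + n)%N => a qa; have [a0 aZ aD] := qa.
pose Q : 'M[R]_(n, 1 + n) := row_mx 0 1%:M.
have QE v : v *m Q = row_mx 0 v by rewrite mul_mx_row mulmx0 mulmx1.
have [|M uM hM] := IH (fun v => a (v *m Q)).
  exact: (quasi_seminorm_comp (mulmxr Q)).
have [|l hl] := complement_vector k1 K0 qa uM.
  by move=> c j; have := hM c j; rewrite !QE.
exists (col_mx (row_mx 1%:M l) (M *m Q)).
  apply: unitmx_col_mx => //.
  by rewrite -block_mxEv unitmxE det_ublock !det1 mulr1 unitr1.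
apply: adapted_step => // t v; rewrite QE.
(* For [t] nonzero, division by [t] moves the vector into the affine hyperplane on which [l] is
   nearly minimal. *)
have [->|t0] := eqVneq t 0; first by rewrite normr0 mul0r mulr_ge0.
have -> : t *: row_mx 1%:M l + row_mx 0 v = t *: row_mx 1%:M (l + t^-1 *: v).
  rewrite !scale_row_mx add_row_mx addr0 scalerDr scalerA divff//.
  by rewrite scale1r.
by rewrite aZ mulrCA ler_wpM2l.
Qed.

(** * Bases adapted to two quasi-seminorms at once *)

Lemma unitmx_inj (n : nat) (A : 'M[R]_n) :
  (forall x : 'rV[R]_n, x *m A = 0 -> x = 0) -> A \in unitmx.
Proof.
move=> hA; rewrite -row_free_unit -kermx_eq0; apply/eqP/row_matrixP => i.
by rewrite row0; apply: hA; rewrite -row_mul mulmx_ker row0.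
Qed.

(** Exchange step: [Q] consists of the rows of [P] other than the [i]-th, so its span is the kernel
    of the [i]-th coordinate functional of [P]. *)
Lemma head_basis (n : nat) (P : 'M[R]_(1 + n)) (c : 'rV[R]_(1 + n))
    (i : 'I_(1 + n)) :
  P \in unitmx -> c 0 i != 0 ->
  exists2 Q : 'M[R]_(n, 1 + n), (col_mx (c *m P) Q : 'M[R]_(1 + n)) \in unitmx &
    forall t v, exists2 x, t *: (c *m P) + v *m Q = x *m P & x 0 i = t * c 0 i.
Proof.
move=> uP ci0; pose E : 'M[R]_(n, 1 + n) := \matrix_(j, l) (lift i j == l)%:R.
have Ei (v : 'rV[R]_n) : (v *m E) 0 i = 0.
  rewrite mxE big1// => j _; rewrite mxE.
  by rewrite eq_sym (negbTE (neq_lift _ _)) mulr0.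
exists (E *m P); last first.
  move=> t v; exists (t *: c + v *m E).
    by rewrite mulmxDl scalemxAl mulmxA.
  by rewrite !mxE [X in _ + X](_ : _ = 0) ?addr0//; have := Ei v; rewrite mxE.
rewrite -mul_col_mx unitmx_mul uP andbT; apply: unitmx_inj => x.
rewrite mul_col_mx_row1 => /matrixP xE.
have t0 : x 0 (lshift n 0) = 0.
  have := xE 0 i; rewrite !mxE [X in _ + X](_ : _ = 0); last first.
    by have := Ei (rsubmx x); rewrite mxE.
  by rewrite addr0 => /eqP; rewrite mulf_eq0 (negbTE ci0) orbF => /eqP.
rewrite -(hsubmxK x) -[RHS]row_mx0; congr row_mx.
  by apply/matrixP => u v; rewrite !ord1 !mxE t0.
apply/matrixP => u j; rewrite ord1 !mxE.
have := xE 0 (lift i j); rewrite t0 scale0r add0r !mxE (bigD1 j)//=.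
rewrite !mxE eqxx mulr1 big1 ?addr0// => l lj; rewrite !mxE.
by rewrite (inj_eq lift_inj) (negbTE lj) mulr0.
Qed.

(** Cross-multiplication lets denominators vanish: an index with [y j] = 0 counts as having infinite
    ratio. *)
Lemma ratio_maximizer (n : nat) (x y : 'I_n.+1 -> R) :
  (forall i, 0 <= y i) -> (forall i, 0 <= x i) ->
  exists j, forall i, x i * y j <= y i * x j.
Proof.
move=> y0 x0; have [[j /eqP yj]|/forallNP yN0] := pselect (exists j, y j == 0).
  by exists j => i; rewrite yj mulr0 mulr_ge0.
have {yN0} yP i : 0 < y i by rewrite lt0r y0 andbT; exact/negP.
have [j _ jmax] := @arg_maxP _ _ _ ord0 xpredT (fun i => x i / y i) isT.
exists j => i; have := jmax i isT.
by rewrite /= ler_pdivrMr// mulrAC ler_pdivlMr// (mulrC (x j)).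
Qed.

(* [w] nearly maximizes the ratio [a true / a false], so a coordinate functional
   which is nearly norming for [a true] at [w] is so for [a false] as well. *)
Lemma common_complement_vector (n : nat) (k : R) : 1 <= k ->
  exists2 K : R, 0 <= K &
    forall a : bool -> 'rV[R]_(1 + n) -> R,
      (forall b, quasi_seminorm k (a b)) ->
    exists w, exists2 Q : 'M[R]_(n, 1 + n),
      (col_mx w Q : 'M[R]_(1 + n)) \in unitmx &
      forall b t v, `|t| * a b w <= K * a b (t *: w + v *m Q).
Proof.
move=> k1; have k0 : 0 <= k by lra.
have [K K0 basis] := adapted_basis (1 + n) k1.
pose B := k ^+ (1 + n) * (1 + n)%:R.
have B0 : 0 <= B by rewrite mulr_ge0 ?exprn_ge0.
have BK0 : 0 <= B * K by exact: mulr_ge0.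
have BBK0 : 0 <= B * K * (B * K) by exact: mulr_ge0.
exists (K + B * K + B * K * (B * K)); first by rewrite !addr_ge0.
move=> a qa; have a0 b x : 0 <= a b x by case: (qa b).
have [M0 uM0 hM0] := basis _ (qa true).
have [M1 uM1 hM1] := basis _ (qa false).
have sum_le (b : bool) (c : 'rV[R]_(1 + n)) (M : 'M[R]_(1 + n)) (X : R) :
    (forall i, `|c 0 i| * a b (row i M) <= X) -> a b (c *m M) <= B * X.
  move=> cX; rewrite (le_trans (quasi_seminorm_mulmx c M k1 (qa b)))//.
  rewrite /B -mulrA ler_wpM2l ?exprn_ge0//.
  rewrite (le_trans (ler_sum _ (G := fun=> X) _))//.
  by rewrite sumr_const card_ord mulr_natl.
(* Expansion in [M1], adapted to [a false], reduces maximizing the ratio over all vectors to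
   maximizing it over the rows, up to a factor [B * K]. *)
clearbody B; have [j hj] := @ratio_maximizer n (fun i => a true (row i M1))
  (fun i => a false (row i M1)) (fun i => a0 _ _) (fun i => a0 _ _).
pose u := row j M1.
have ratio x : a true x * a false u <= B * K * a false x * a true u.
  have [fu0|fu0] := eqVneq (a false u) 0.
    by rewrite fu0 mulr0 mulr_ge0// mulr_ge0.
  have {}fu0 : 0 < a false u by rewrite lt0r fu0 a0.
  rewrite -ler_pdivlMr// -{1}(mulmxKV uM1 x) -!mulrA.
  apply: sum_le => i; rewrite !mulrA ler_pdivlMr// -!mulrA.
  rewrite (le_trans (ler_wpM2l _ (hj i)))// !mulrA ler_wpM2r//.
  by rewrite (le_trans (hM1 _ _))// mulmxKV.
(* Here the claim for [true] is trivial, and the [j]-th coordinate of [M1] serves for [false]. *)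
have [u0|u0] := eqVneq (a true u) 0.
  have [|Q uQ hQ] := @head_basis n M1 (delta_mx 0 j) j uM1.
    by rewrite mxE !eqxx oner_eq0.
  have uE : u = delta_mx 0 j *m M1 by exact: rowE.
  exists u, Q; first by rewrite uE.
  move=> b t v; have [x] := hQ t v; rewrite -uE => ->.
  rewrite mxE !eqxx mulr1 /= => <-.
  case: b; first by rewrite u0 mulr0 mulr_ge0// !addr_ge0.
  by rewrite (le_trans (hM1 _ _))// ler_wpM2r// -addrA lerDl addr_ge0.
have {}u0 : 0 < a true u by rewrite lt0r u0 a0.
(* In the expansion of [u] in [M0], adapted to [a true], the largest term is at least
   [a true u / B]. Hence the [i]-th coordinate functional is nearly norming at [u]. *)
pose c := u *m invmx M0; have uE : u = c *m M0 by rewrite mulmxKV.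
have [i _ imax] := @arg_maxP _ _ _ (0 : 'I_(1 + n)) xpredT
  (fun i => `|c 0 i| * a true (row i M0)) isT.
have norming : a true u <= B * (`|c 0 i| * a true (row i M0)).
  by rewrite {1}uE; apply: sum_le => l; exact: imax.
have ci0 : c 0 i != 0.
  by apply: contraTneq norming => ->; rewrite normr0 mul0r mulr0 -ltNge.
have [Q uQ hQ] := head_basis uM0 ci0; exists u, Q; first by rewrite uE.
move=> b t v; have [x] := hQ t v; rewrite -uE => -> xi.
set z := x *m M0.
have tnorm : `|t| * a true u <= B * K * a true z.
  rewrite (le_trans (ler_wpM2l (normr_ge0 t) norming))// mulrCA -mulrA.
  by rewrite ler_wpM2l// mulrA -normrM -xi; exact: hM0.
case: b.
  by rewrite (le_trans tnorm)// ler_wpM2r// -addrA addrCA lerDl addr_ge0//.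
(* For [false], multiply by [a true u], apply [tnorm], and let [ratio] trade [a true z] for
   [a false z]. *)
rewrite -(ler_pM2r u0) (mulrAC `|t|).
rewrite (le_trans (ler_wpM2r (a0 false u) tnorm))//.
rewrite -[leLHS]mulrA (le_trans (ler_wpM2l BK0 (ratio z)))// !mulrA.
by rewrite !ler_wpM2r// lerDr addr_ge0.
Qed.

(** The same [w] and [Q] serve both quasi-seminorms, so the recursion into the span of [Q] runs for
    both at once. *)
Lemma common_adapted_basis (n : nat) (k : R) : 1 <= k ->
  exists2 K : R, 0 <= K & forall a : bool -> 'rV[R]_n -> R,
    (forall b, quasi_seminorm k (a b)) ->
    exists2 M : 'M[R]_n, M \in unitmx & forall b, adapted K (a b) M.
Proof.
move=> k1; have k0 : 0 <= k by lra.
elim: n => [|n [K K0 IH]].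
  by exists 0 => // a _; exists 1%:M; [exact: unitmx1 | move=> b c []].
have [K1 K10 hK1] := common_complement_vector n k1.
exists (K1 + K * k * (1 + K1)).
  by rewrite addr_ge0// !mulr_ge0// addr_ge0.
rewrite -[n.+1]/(1 + n)%N => a qa; have [w [Q uQ hQ]] := hK1 a qa.
have [|M uM hM] := IH (fun b v => a b (v *m Q)).
  by move=> b; exact: (quasi_seminorm_comp (mulmxr Q)).
exists (col_mx w (M *m Q)); first exact: unitmx_col_mx.
by move=> b; apply: adapted_step => //.
Qed.
End QuasiSeminorms.

(** * Lebesgue quasi-norms *)

Section Lnorms.
Context (R : realType) (d : measure_display) (T : measurableType d).
Variable mu : {measure set T -> \bar R}.
Local Open Scope ereal_scope.

(* No measurability is assumed: the inner norms of [mixed_norm] need not be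
   measurable functions, the measures not being sigma-finite. *)
Lemma le_integral_nonmeasurable (f g : T -> \bar R) :
  (forall x, 0 <= f x) -> (forall x, f x <= g x) ->
  \int[mu]_x f x <= \int[mu]_x g x.
Proof.
move=> f0 fg; rewrite !ge0_integralTE//; last first.
  by move=> x; rewrite (le_trans (f0 x)).
apply: ereal_sup_le; apply: image_subset => h /= hf x.
by rewrite (le_trans (hf x)).
Qed.

Lemma le_Lnorm (p : \bar R) (f g : T -> \bar R) :
  0 < p -> (forall x, `|f x| <= `|g x|) -> 'N[mu]_p[f] <= 'N[mu]_p[g].
Proof.
rewrite unlock; case: p => [p||//].
  rewrite lte_fin => p0 fg; apply: gt0_ler_poweR.
  - by rewrite invr_ge0 ltW.
  - by rewrite in_itv/= leey andbT integral_ge0// => x _; rewrite poweR_ge0.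
  - by rewrite in_itv/= leey andbT integral_ge0// => x _; rewrite poweR_ge0.
  apply: le_integral_nonmeasurable => x; first exact: poweR_ge0.
  by apply: gt0_ler_poweR; rewrite ?in_itv/= ?leey ?andbT ?abse_ge0// ltW.
move=> _ fg; case: ifPn => // _; apply: le_ess_sup; exact/nearW.
Qed.

Lemma measurable_poweR_normr (p : R) (f : T -> R) :
  measurable_fun [set: T] f ->
  measurable_fun [set: T] (fun x => `|(f x)%:E| `^ p).
Proof.
move=> mf; apply: (@measurableT_comp _ _ _ _ _ _ (fun x => x `^ p)).
  exact: measurable_poweR.
by apply: measurableT_comp => //; exact/measurable_EFinP.
Qed.

Lemma LnormZ (p : \bar R) (c : R) (f : T -> R) :
  0 < p -> measurable_fun [set: T] f ->
  'N[mu]_p[(fun x => (c * f x)%:E)] = `|c|%:E * 'N[mu]_p[EFin \o f].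
Proof.
rewrite unlock; case: p => [p||//].
  rewrite lte_fin => p0 mf.
  under eq_integral => x _ do rewrite EFinM abseM poweRM//.
  have Ip : 0 <= \int[mu]_x (`|(f x)%:E| `^ p).
    by apply: integral_ge0 => x _; exact: poweR_ge0.
  rewrite ge0_integralZl ?poweR_ge0//; last first.
    by move=> x _; exact: poweR_ge0.
    exact: measurable_poweR_normr.
  by rewrite poweRM ?poweR_ge0// -poweRrM mulfV ?gt_eqF// poweRe1.
move=> _ mf; case: ifPn => [mu0|_]; last by rewrite mule0.
rewrite -ess_supZl//; congr ess_sup; apply/funext => x /=.
by rewrite normrM.
Qed.

Lemma ae_eq_Lnorm (p : \bar R) (f g : T -> R) :
  measurable_fun [set: T] f -> measurable_fun [set: T] g ->
  (\forall x \ae mu, f x = g x) ->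
  'N[mu]_p[EFin \o f] = 'N[mu]_p[EFin \o g].
Proof.
move=> mf mg fg; rewrite unlock; case: p => [p||].
- congr (_ `^ _); apply: ge0_ae_eq_integral => //.
  + exact: measurable_poweR_normr.
  + exact: measurable_poweR_normr.
  + by move=> x _; exact: poweR_ge0.
  + by move=> x _; exact: poweR_ge0.
  + by apply: filterS fg => x /= ->.
- by case: ifPn => // _; apply: eq_ess_sup; apply: filterS fg => x /= ->.
- by case: ifPn => // _; apply: eq_ess_inf; apply: filterS fg => x /= ->.
Qed.

End Lnorms.

(* At [p = +oo], [fine p = 0] and [0^-1 = 0], so that the value is 2. *)
Definition Lnorm_quasi_constant (R : realType) (p : \bar R) : R :=
  2 * 2 `^ (fine p)^-1.

Lemma Lnorm_quasi_constant_ge1 (R : realType) (p : \bar R) :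
  (0 < p)%E -> 1 <= Lnorm_quasi_constant p.
Proof.
move=> p0; have : 1 <= 2 `^ (fine p)^-1 :> R.
  rewrite -[leLHS](powRr0 2) ler_powR ?ler1n// invr_ge0 fine_ge0// ltW//.
rewrite /Lnorm_quasi_constant; lra.
Qed.

(** Bounding [x + y] by twice the larger term covers convex and concave powers alike. *)
Lemma poweR_add_le (R : realType) (s : R) (x y : \bar R) :
  0 <= s -> (0 <= x)%E -> (0 <= y)%E ->
  ((x + y) `^ s <= (2 `^ s)%:E * (x `^ s + y `^ s))%E.
Proof.
move=> s0; wlog xy : x y / (x <= y)%E.
  move=> H x0 y0; have [|/ltW] := leP x y; first by move/H; apply.
  by move/H => /(_ y0 x0); rewrite addeC (addeC (y `^ s)%E).
move=> x0 y0; apply: (@le_trans _ _ ((2%:E * y) `^ s)%E).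
  apply: gt0_ler_poweR => //;
    rewrite ?in_itv/= ?leey ?andbT ?adde_ge0 ?mule_ge0//.
  by rewrite (_ : 2%:E * y = y + y)%E ?leeD2r// mule_natl mule2n.
rewrite poweRM// poweR_EFin lee_wpmul2l ?lee_fin ?powR_ge0//.
by rewrite leeDr// poweR_ge0.
Qed.

(** For finite [p], [poweR_add_le] is applied with exponent [p] inside the integral and with [p^-1]
    outside: the factor 2^p becomes 2 under the root, and the outer step gives 2^(1/p). At [p] = +oo
    this is weaker than Minkowski's inequality. *)
Lemma LnormD (R : realType) (d : measure_display) (T : measurableType d)
    (mu : {measure set T -> \bar R}) (p : \bar R) (f g : T -> R) :
  (0 < p)%E -> measurable_fun [set: T] f -> measurable_fun [set: T] g ->
  ('N[mu]_p[(fun x => (f x + g x)%:E)] <= (Lnorm_quasi_constant p)%:E *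
     ('N[mu]_p[EFin \o f] + 'N[mu]_p[EFin \o g]))%E.
Proof.
move=> + mf mg; case: p => [p||//]; last first.
  move=> _; rewrite (le_trans (eminkowski mu mf mg (leey 1)))//.
  by rewrite lee_pemull ?adde_ge0 ?Lnorm_ge0// lee_fin Lnorm_quasi_constant_ge1.
rewrite lte_fin => p0; rewrite unlock [Lnorm_quasi_constant _]/(2 * 2 `^ p^-1).
have I0 (h : T -> R) : (0 <= \int[mu]_x (`|(h x)%:E| `^ p))%E.
  by apply: integral_ge0 => x _; exact: poweR_ge0.
apply: (@le_trans _ _ (((2 `^ p)%:E * (\int[mu]_x (`|(f x)%:E| `^ p) +
    \int[mu]_x (`|(g x)%:E| `^ p))) `^ p^-1)%E).
  apply: gt0_ler_poweR; rewrite ?invr_ge0 ?in_itv/= ?leey ?andbT ?(ltW p0)//.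
    exact: (I0 (fun x => f x + g x)).
    by rewrite mule_ge0 ?lee_fin ?powR_ge0// adde_ge0 ?I0.
  rewrite -ge0_integralD//; [|exact: measurable_poweR_normr..].
  rewrite -ge0_integralZl ?lee_fin ?powR_ge0//; last 2 first.
    by apply: emeasurable_funD; exact: measurable_poweR_normr.
    by move=> x _; rewrite adde_ge0 ?poweR_ge0.
  apply: le_integral_nonmeasurable => x; first by rewrite lee_fin powR_ge0.
  apply: le_trans (@poweR_add_le R p `|f x|%:E `|g x|%:E _ _ _) => //.
    by rewrite lee_fin ge0_ler_powR ?nnegrE ?addr_ge0 ?(ltW p0) ?ler_normD.
  exact: ltW.
rewrite poweRM ?lee_fin ?powR_ge0//; last by rewrite adde_ge0 ?I0.
move: (I0 f) (I0 g); rewrite /comp.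
move: (\int[mu]_x _)%E => If; move: (\int[mu]_x _)%E => Ig If0 Ig0.
rewrite poweR_EFin -powRrM mulfV ?gt_eqF// powRr1// EFinM -muleA.
by rewrite lee_wpmul2l ?lee_fin// poweR_add_le ?invr_ge0 ?(ltW p0).
Qed.

(** * Lower bounds for mixed norms *)

Lemma quasi_seminorm_le (R : realType) (V : lmodType R) (k k' : R)
    (a : V -> R) :
  k <= k' -> quasi_seminorm k a -> quasi_seminorm k' a.
Proof.
move=> kk' [a0 aZ aD]; split=> // x y; rewrite (le_trans (aD x y))//.
by rewrite ler_wpM2r// addr_ge0.
Qed.

Lemma adapted_le (R : realType) (n : nat) (k K K' : R) (a : 'rV[R]_n -> R)
    (M : 'M[R]_n) :
  K <= K' -> quasi_seminorm k a -> adapted K a M -> adapted K' a M.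
Proof.
move=> KK' [a0 _ _] aM c j; rewrite (le_trans (aM c j))//.
by rewrite ler_wpM2r.
Qed.

Section LfunSeminorm.
Context (R : realType) (d : measure_display) (T : measurableType d).
Variables (mu : {measure set T -> \bar R}) (p : \bar R).

Lemma LfunE (f : T -> R) :
  (f \in Lfun mu p) <->
  (measurable_fun [set: T] f /\ ('N[mu]_p[EFin \o f] < +oo)%E).
Proof.
split=> [/andP[]|[mf ff]]; rewrite ?inE//.
by apply/andP; rewrite !inE.
Qed.

Hypothesis p0 : (0 < p)%E.

Lemma Lfun_lincomb (n : nat) (c : 'I_n -> R) (f : 'I_n -> T -> R) :
  (forall i, f i \in Lfun mu p) ->
  (fun t => \sum_(i < n) c i * f i t) \in Lfun mu p.
Proof.
elim: n c f => [|n IHn] c f hf; apply/LfunE.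
  have -> : (fun t => \sum_(i < 0) c i * f i t) = cst 0.
    by apply/funext => t; rewrite big_ord0.
  by split; [exact: measurable_cst | rewrite Lnorm0 ?gt_eqF].
have -> : (fun t => \sum_(i < n.+1) c i * f i t) =
  (fun t => \sum_(i < n) c (widen_ord (leqnSn n) i) *
    f (widen_ord (leqnSn n) i) t + c ord_max * f ord_max t).
  by apply/funext => t; rewrite big_ord_recr.
have /LfunE[mg fg] := IHn (fun i => c (widen_ord (leqnSn n) i))
  (fun i => f (widen_ord (leqnSn n) i)) (fun i => hf _).
have /LfunE[mf ff] := hf ord_max.
have mcf : measurable_fun [set: T] (fun t => c ord_max * f ord_max t).
  by apply: measurable_funM.
split; first exact: measurable_funD.
rewrite (le_lt_trans (LnormD mu p0 mg mcf))// lte_mul_pinfty//.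
  by rewrite lee_fin (le_trans ler01)// Lnorm_quasi_constant_ge1.
by rewrite lte_add_pinfty// LnormZ// lte_mul_pinfty.
Qed.

Definition lincomb (n : nat) (f : 'I_n -> T -> R) (c : 'rV[R]_n) (t : T) : R :=
  \sum_(i < n) c 0 i * f i t.

(** [fine] would send an infinite norm to 0; for [p] > 0 and all [f i] in [Lfun mu p] the norm is
    finite. *)
Definition Lseminorm (n : nat) (f : 'I_n -> T -> R) (c : 'rV[R]_n) : R :=
  fine 'N[mu]_p[EFin \o lincomb f c]%E.

Variables (n : nat) (f : 'I_n -> T -> R).
Hypothesis hf : forall i, f i \in Lfun mu p.

Lemma measurable_lincomb (c : 'rV[R]_n) : measurable_fun [set: T] (lincomb f c).
Proof. by have /LfunE[] := Lfun_lincomb (c 0) hf. Qed.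

Lemma LseminormE (c : 'rV[R]_n) :
  (Lseminorm f c)%:E = 'N[mu]_p[EFin \o lincomb f c]%E.
Proof.
have /LfunE[_ fc] := Lfun_lincomb (c 0) hf.
by rewrite fineK// ge0_fin_numE ?Lnorm_ge0.
Qed.

Lemma Lseminorm_quasi_seminorm :
  quasi_seminorm (Lnorm_quasi_constant p) (Lseminorm f).
Proof.
split=> [x|c x|x y].
- by rewrite fine_ge0// Lnorm_ge0.
- apply: EFin_inj; rewrite EFinM !LseminormE -LnormZ//; last first.
    exact: measurable_lincomb.
  apply: eq_Lnorm => t /=; congr EFin; rewrite /lincomb mulr_sumr.
  by apply: eq_bigr => i _; rewrite mxE mulrA.
- rewrite -lee_fin EFinM EFinD !LseminormE.
  apply: le_trans (LnormD mu p0 (measurable_lincomb x) (measurable_lincomb y)).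
  rewrite le_eqVlt; apply/orP; left; apply/eqP.
  apply: eq_Lnorm => t /=; congr EFin; rewrite /lincomb -big_split.
  by apply: eq_bigr => i _; rewrite mxE mulrDl.
Qed.

End LfunSeminorm.

Section MixedNorms.
Context (R : realType) (dX dY : measure_display) (X : measurableType dX)
  (Y : measurableType dY).
Variables (mu : {measure set X -> \bar R}) (nu : {measure set Y -> \bar R}).
Variables (p q : \bar R) (n : nat) (f : 'I_n -> X -> R) (g : 'I_n -> Y -> R).
Hypotheses (p0 : (0 < p)%E) (q0 : (0 < q)%E).
Hypotheses (hf : forall i, f i \in Lfun mu p).
Hypotheses (hg : forall i, g i \in Lfun nu q).

(** For fixed [x] the inner norm is [Lseminorm nu q g] at the row vector of the [f l x], whose
    [i]-th coordinate in the basis [P] is [lincomb f (row i (invmx P)^T) x]. Adaptedness gives a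
    bound pointwise in [x], to which the outer norm is applied. *)
Lemma mixed_norm_xy_ge (K : R) (P : 'M[R]_n) (i : 'I_n) :
  0 < K -> P \in unitmx -> adapted K (Lseminorm nu q g) P ->
  ((Lseminorm nu q g (row i P) * Lseminorm mu p f (row i (invmx P)^T))%:E <=
   K%:E *
   mixed_norm_xy mu nu p q (fun x y => (\sum_(l < n) f l x * g l y)%R))%E.
Proof.
move=> K0 uP aP; rewrite -lee_pdivrMl// -EFinM mulrA.
set s := K^-1 * _.
have s0 : 0 <= s.
  rewrite mulr_ge0 ?invr_ge0 ?(ltW K0)//.
  by have [] := Lseminorm_quasi_seminorm q0 hg.
have -> : (s * Lseminorm mu p f (row i (invmx P)^T))%:E =
    'N[mu]_p[(fun x => (s * lincomb f (row i (invmx P)^T) x)%:E)]%E.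
  rewrite LnormZ//; last exact: measurable_lincomb hf _.
  by rewrite EFinM LseminormE// ger0_norm.
apply: le_Lnorm => // x; pose v := \row_l f l x.
have -> : ('N[nu]_q[(fun y => (\sum_(l < n) f l x * g l y)%R%:E)] =
    (Lseminorm nu q g v)%:E)%E.
  rewrite LseminormE//; apply: eq_Lnorm => y /=; congr EFin.
  by apply: eq_bigr => l _; rewrite mxE.
have -> : lincomb f (row i (invmx P)^T) x = (v *m invmx P) 0 i.
  by rewrite mxE; apply: eq_bigr => l _; rewrite !mxE mulrC.
rewrite /= lee_fin normrM ger0_norm// [leRHS]ger0_norm; last first.
  by have [] := Lseminorm_quasi_seminorm q0 hg.
rewrite /s -mulrA ler_pdivrMl// mulrC.
by have := aP (v *m invmx P) i; rewrite mulmxKV.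
Qed.
End MixedNorms.

Section DualBases.
Context (R : realType) (dX dY : measure_display) (X : measurableType dX)
  (Y : measurableType dY).
Variables (mu : {measure set X -> \bar R}) (nu : {measure set Y -> \bar R}).
Variables (p q : \bar R) (n : nat) (f : 'I_n -> X -> R) (g : 'I_n -> Y -> R).
Hypotheses (p0 : (0 < p)%E) (q0 : (0 < q)%E).
Hypotheses (hf : forall i, f i \in Lfun mu p).
Hypotheses (hg : forall i, g i \in Lfun nu q).

(** The constant adds the costs of the two orders of integration, so as not to depend on [swap]. *)
Lemma mixed_norm_ge (k K : R) (M P : 'M[R]_n) (swap : bool) (j : 'I_n) :
  1 <= k -> Lnorm_quasi_constant q <= k ->
  0 < K -> M \in unitmx -> P \in unitmx ->
  adapted K (Lseminorm mu p f) M -> adapted K (Lseminorm nu q g) P ->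
  ((Lseminorm mu p f (row j M) * Lseminorm nu q g (row j (invmx M)^T))%:E <=
   (K + k ^+ n * n%:R * K * K)%:E *
   mixed_norm mu nu p q swap (fun x y => (\sum_(l < n) f l x * g l y)%R))%E.
Proof.
move=> k1 qk K0 uM uP aM aP; have k0 : 0 <= k by lra.
set a := Lseminorm mu p f; set b := Lseminorm nu q g.
have a0 c : 0 <= a c by have [] := Lseminorm_quasi_seminorm p0 hf.
have b0 c : 0 <= b c by have [] := Lseminorm_quasi_seminorm q0 hg.
have qb : quasi_seminorm k b.
  exact: quasi_seminorm_le qk (Lseminorm_quasi_seminorm q0 hg).
have L0 : 0 <= k ^+ n * n%:R * K * K.
  by rewrite mulr_ge0 ?(ltW K0)// mulr_ge0 ?(ltW K0)// mulr_ge0// exprn_ge0.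
have N0 : (0 <= mixed_norm mu nu p q swap
      (fun x y => (\sum_(l < n) f l x * g l y)%R))%E.
  by case: swap; exact: Lnorm_ge0.
rewrite EFinD ge0_muleDl ?lee_fin ?(ltW K0)//.
(* Inner norm in [x]: with the two factors exchanged, [mixed_norm_xy_ge] applies to [M] directly. *)
case: swap N0 => N0.
  rewrite -[leLHS]adde0 leeD//; last by rewrite mule_ge0 ?lee_fin.
  have := mixed_norm_xy_ge q0 p0 hg hf j K0 uM aM.
  congr (_ <= _ * _)%E; congr Lnorm; apply/funext => y.
  apply: eq_Lnorm => x; congr EFin.
  by apply: eq_bigr => l _; rewrite mulrC.
rewrite -[leLHS]add0e leeD//; first by rewrite mule_ge0 ?lee_fin ?(ltW K0).
have := fun i => mixed_norm_xy_ge p0 q0 hf hg i K0 uP aP.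
rewrite /mixed_norm -/a -/b; set N := mixed_norm_xy _ _ _ _ _.
move: N0; rewrite /mixed_norm -/N.
(* Inner norm in [y]: [E] expresses the dual basis of [M] in [P], and [E^T] the dual basis of [P] in
   [M]. Adaptedness of [M] thus bounds [a (row j M)] times the absolute value of [E j i] by
   [K * a (row i (invmx P)^T)]. *)
pose E := (invmx M)^T *m invmx P.
have EP : row j (invmx M)^T = row j E *m P by rewrite -row_mul mulmxKV.
have ED i : row i (invmx P)^T = row i E^T *m M.
  by rewrite -row_mul trmx_mul trmxK mulmxKV.
case: N => [N _ NK| |//]; last first.
  have n0 : 0 < n%:R :> R by rewrite ltr0n (leq_ltn_trans _ (ltn_ord j)).
  move=> _ _; rewrite gt0_muley ?leey// lte_fin !mulr_gt0// exprn_gt0//; lra.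
rewrite -EFinM lee_fin EP.
rewrite (le_trans (ler_wpM2l (a0 _) (quasi_seminorm_mulmx _ _ k1 qb)))//.
rewrite mulrCA -!mulrA ler_wpM2l ?exprn_ge0// mulr_sumr.
rewrite (le_trans (ler_sum _ (G := fun=> K * (K * N)) _))//; last first.
  by rewrite sumr_const card_ord mulr_natl.
move=> i _; have := NK i; rewrite -EFinM lee_fin => NKi.
rewrite [leLHS]mulrA (le_trans _ (ler_wpM2l (ltW K0) NKi))//.
rewrite [leRHS]mulrCA [leLHS]mulrC ler_wpM2l//.
by have := aM (row i E^T) j; rewrite -ED !mxE mulrC.
Qed.
End DualBases.

(** * Lebesgue-valued operators under a change of basis *)

Section LpValued.
Context (R : realType) (F : lmodType R) (d : measure_display)
  (T : measurableType d).
Variables (mu : {measure set T -> \bar R}) (p : \bar R) (A : F -> T -> R).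
Hypothesis hA : Lp_valued_linear mu p A.

Lemma Lp_valued_linear_sum (n : nat) (c : 'I_n -> R) (f : 'I_n -> F) :
  \forall t \ae mu,
    A (\sum_(i < n) c i *: f i) t = \sum_(i < n) c i * A (f i) t.
Proof.
have [_ linA] := hA; elim: n c f => [|n IHn] c f.
  (* Additivity at 0 gives [A 0 = A 0 + A 0], hence [A 0 = 0], almost everywhere. *)
  have := linA 1 0 0; rewrite scaler0 addr0 big_ord0; apply: filterS => t.
  by rewrite mul1r big_ord0 => /eqP; rewrite -subr_eq0 opprD addrA subrr sub0r
    oppr_eq0 => /eqP.
rewrite big_ord_recl.
have := IHn (fun i => c (lift ord0 i)) (fun i => f (lift ord0 i)).
have := linA (c ord0) (f ord0)
  (\sum_(i < n) c (lift ord0 i) *: f (lift ord0 i)).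
by apply: filterS2 => t -> ->; rewrite big_ord_recl.
Qed.

Lemma Lp_valued_linear_norm (n : nat) (c : 'rV[R]_n) (f : 'I_n -> F) :
  (0 < p)%E ->
  'N[mu]_p[EFin \o A (\sum_(i < n) c 0 i *: f i)]%E =
  (Lseminorm mu p (fun i => A (f i)) c)%:E.
Proof.
move=> p0; have [LA _] := hA; rewrite LseminormE//.
apply: ae_eq_Lnorm; last exact: Lp_valued_linear_sum.
  by have /LfunE[] := LA (\sum_(i < n) c 0 i *: f i).
exact: (measurable_lincomb p0 (fun i => LA (f i)) c).
Qed.
End LpValued.

Lemma Lp_valued_bilinear_sum (R : realType) (F G : lmodType R)
    (d : measure_display) (T : measurableType d)
    (mu : {measure set T -> \bar R}) (p : \bar R) (tau : F -> G -> T -> R)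
    (n : nat) (b c : 'I_n -> R) (f : 'I_n -> F) (g : 'I_n -> G) :
  Lp_valued_bilinear mu p tau ->
  \forall t \ae mu, tau (\sum_(i < n) b i *: f i) (\sum_(l < n) c l *: g l) t =
    \sum_(i < n) \sum_(l < n) b i * c l * tau (f i) (g l) t.
Proof.
move=> [taul taur].
have H1 := Lp_valued_linear_sum (taul (\sum_(l < n) c l *: g l)) b f.
have H2 : \forall t \ae mu, forall i, tau (f i) (\sum_(l < n) c l *: g l) t =
    \sum_(l < n) c l * tau (f i) (g l) t.
  apply: filter_forall => i.
  exact (Lp_valued_linear_sum (taur (f i)) c g).
apply: filterS2 H1 H2 => t -> H2; apply: eq_bigr => i _.
by rewrite H2 mulr_sumr; apply: eq_bigr => l _; rewrite mulrA.
Qed.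

Lemma Lp_valued_bilinear_dual (R : realType) (F G : lmodType R)
    (d : measure_display) (T : measurableType d)
    (mu : {measure set T -> \bar R}) (p : \bar R) (tau : F -> G -> T -> R)
    (n : nat) (M : 'M[R]_n) (f : 'I_n -> F) (g : 'I_n -> G) :
  M \in unitmx -> Lp_valued_bilinear mu p tau ->
  \forall t \ae mu, \sum_(i < n) tau (f i) (g i) t =
    \sum_(j < n) tau (\sum_(i < n) row j M 0 i *: f i)
      (\sum_(l < n) row j (invmx M)^T 0 l *: g l) t.
Proof.
move=> uM htau.
have H : \forall t \ae mu, forall j : 'I_n,
    tau (\sum_(i < n) row j M 0 i *: f i)
      (\sum_(l < n) row j (invmx M)^T 0 l *: g l) t =
    \sum_(i < n) \sum_(l < n) row j M 0 i * row j (invmx M)^T 0 l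
      * tau (f i) (g l) t.
  apply: filter_forall => j.
  exact (Lp_valued_bilinear_sum (row j M 0) (row j (invmx M)^T 0) f g htau).
apply: filterS H => t H; rewrite (eq_bigr _ (fun j _ => H j)) exchange_big /=.
apply: eq_bigr => i _; rewrite exchange_big /=.
have dual l : \sum_(j < n) row j M 0 i * row j (invmx M)^T 0 l = (l == i)%:R.
  have := mulVmx uM => /matrixP/(_ l i); rewrite !mxE => <-.
  by apply: eq_bigr => j _; rewrite !mxE mulrC.
under eq_bigr do rewrite -mulr_suml dual.
rewrite (bigD1 i)//= eqxx mul1r big1 ?addr0// => l /negbTE ->.
by rewrite mul0r.
Qed.

Theorem theorem1p14 (R : realType) (p0 p1 q0 q1 r : \bar R)
    (hp0 : (0 < p0)%E) (hp1 : (0 < p1)%E) (hq0 : (0 < q0)%E)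
    (hq1 : (0 < q1)%E) (hr : (0 < r)%E)
    (C : R) (n : nat) (hn : (1 <= n)%N) :
  exists C' : R,
    forall (F G : lmodType R)
      (dX0 : measure_display) (X0 : measurableType dX0)
      (mu0 : {measure set X0 -> \bar R})
      (dX1 : measure_display) (X1 : measurableType dX1)
      (mu1 : {measure set X1 -> \bar R})
      (dY0 : measure_display) (Y0 : measurableType dY0)
      (nu0 : {measure set Y0 -> \bar R})
      (dY1 : measure_display) (Y1 : measurableType dY1)
      (nu1 : {measure set Y1 -> \bar R})
      (dZ : measure_display) (Z : measurableType dZ)
      (rho : {measure set Z -> \bar R})
      (A0 : F -> X0 -> R) (A1 : F -> X1 -> R)
      (B0 : G -> Y0 -> R) (B1 : G -> Y1 -> R)
      (tau : F -> G -> Z -> R),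
    Lp_valued_linear mu0 p0 A0 -> Lp_valued_linear mu1 p1 A1 ->
    Lp_valued_linear nu0 q0 B0 -> Lp_valued_linear nu1 q1 B1 ->
    Lp_valued_bilinear rho r tau ->
    (forall (f : F) (g : G),
      ('N[rho]_r[EFin \o tau f g] <=
         C%:E * ('N[mu0]_p0[EFin \o A0 f] * 'N[nu0]_q0[EFin \o B0 g] +
                 'N[mu1]_p1[EFin \o A1 f] * 'N[nu1]_q1[EFin \o B1 g]))%E) ->
    forall (f : 'I_n -> F) (g : 'I_n -> G) (swap0 swap1 : bool),
      ('N[rho]_r[(fun z : Z => (\sum_(i < n) tau (f i) (g i) z)%R%:E)] <=
         C'%:E * (mixed_norm mu0 nu0 p0 q0 swap0 (dot_product A0 B0 f g) +
                  mixed_norm mu1 nu1 p1 q1 swap1 (dot_product A1 B1 f g)))%E.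
Proof.
(* All five constants are at least 1, so their sum dominates each of them. *)
pose k : R := Lnorm_quasi_constant p0 + Lnorm_quasi_constant p1 +
  Lnorm_quasi_constant q0 + Lnorm_quasi_constant q1 + Lnorm_quasi_constant r.
have [kp0 kp1 kq0 kq1 kr] : [/\ Lnorm_quasi_constant p0 <= k,
    Lnorm_quasi_constant p1 <= k, Lnorm_quasi_constant q0 <= k,
    Lnorm_quasi_constant q1 <= k & Lnorm_quasi_constant r <= k].
  have := Lnorm_quasi_constant_ge1 hp0; have := Lnorm_quasi_constant_ge1 hp1.
  have := Lnorm_quasi_constant_ge1 hq0; have := Lnorm_quasi_constant_ge1 hq1.
  by have := Lnorm_quasi_constant_ge1 hr; rewrite /k; split; lra.
have k1 : 1 <= k by rewrite (le_trans (Lnorm_quasi_constant_ge1 hr)).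
have [K0 K00 common] := common_adapted_basis n k1.
have [K1 K10 basis] := adapted_basis n k1.
pose K := K0 + K1 + 1.
have K_gt0 : 0 < K by rewrite /K; lra.
pose L := K + k ^+ n * n%:R * K * K.
have L_gt0 : 0 < L.
  rewrite /L ltr_wpDr// mulr_ge0 ?(ltW K_gt0)// mulr_ge0 ?(ltW K_gt0)//.
  by rewrite mulr_ge0// exprn_ge0//; lra.
(* [C] may be negative or zero; |C| + 1 is a positive upper bound for it. *)
pose D := (`|C| + 1) * L.
have D_gt0 : 0 < D by rewrite mulr_gt0// ltr_wpDl.
(* Each of the [n] transformed terms costs [D], and adding them in L^r costs [k ^+ n]. Positivity,
   which uses [n >= 1], matters for infinite mixed norms, since 0 times +oo is 0. *)
exists (k ^+ n * (n%:R * D)).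
have C'_gt0 : 0 < k ^+ n * (n%:R * D).
  by rewrite !mulr_gt0 ?ltr0n// exprn_gt0//; lra.
move=> F G dX0 X0 mu0 dX1 X1 mu1 dY0 Y0 nu0 dY1 Y1 nu1 dZ Z rho.
move=> A0 A1 B0 B1 tau hA0 hA1 hB0 hB1 htau bound f g swap0 swap1.
have LA0 i : A0 (f i) \in Lfun mu0 p0 by case: hA0.
have LA1 i : A1 (f i) \in Lfun mu1 p1 by case: hA1.
have LB0 i : B0 (g i) \in Lfun nu0 q0 by case: hB0.
have LB1 i : B1 (g i) \in Lfun nu1 q1 by case: hB1.
have qA0 := quasi_seminorm_le kp0 (Lseminorm_quasi_seminorm hp0 LA0).
have qA1 := quasi_seminorm_le kp1 (Lseminorm_quasi_seminorm hp1 LA1).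
have qB0 := quasi_seminorm_le kq0 (Lseminorm_quasi_seminorm hq0 LB0).
have qB1 := quasi_seminorm_le kq1 (Lseminorm_quasi_seminorm hq1 LB1).
have [K0K K1K] : K0 <= K /\ K1 <= K by rewrite /K; split; lra.
have [|M uM adM] := common (fun b => if b
    then Lseminorm mu0 p0 (fun i => A0 (f i))
    else Lseminorm mu1 p1 (fun i => A1 (f i))); first by case.
have adM0 := adapted_le K0K qA0 (adM true).
have adM1 := adapted_le K0K qA1 (adM false).
(* [P0] and [P1] may differ, as each enters only the estimate for its own mixed norm; [M] has to be
   common because it transforms [tau]. *)
have [P0 uP0 /(adapted_le K1K qB0) adP0] := basis _ qB0.
have [P1 uP1 /(adapted_le K1K qB1) adP1] := basis _ qB1.
set m0 := mixed_norm _ _ p0 _ _ _; set m1 := mixed_norm _ _ p1 _ _ _.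
have m00 : (0 <= m0)%E by rewrite /m0; case: (swap0); exact: Lnorm_ge0.
have m10 : (0 <= m1)%E by rewrite /m1; case: (swap1); exact: Lnorm_ge0.
have ge0 j := mixed_norm_ge hp0 hq0 LA0 LB0 swap0 j
  k1 kq0 K_gt0 uM uP0 adM0 adP0.
have ge1 j := mixed_norm_ge hp1 hq1 LA1 LB1 swap1 j
  k1 kq1 K_gt0 uM uP1 adM1 adP1.
pose f' j := \sum_(i < n) row j M 0 i *: f i.
pose g' j := \sum_(l < n) row j (invmx M)^T 0 l *: g l.
pose t j := tau (f' j) (g' j).
have Lt j : t j \in Lfun rho r.
  by have [/(_ (g' j))[Lf' _] _] := htau; exact: Lf'.
have tD j : ('N[rho]_r[EFin \o t j] <= D%:E * (m0 + m1))%E.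
  rewrite (le_trans (bound (f' j) (g' j)))//.
  rewrite (Lp_valued_linear_norm hA0)// (Lp_valued_linear_norm hA1)//.
  rewrite (Lp_valued_linear_norm hB0)// (Lp_valued_linear_norm hB1)//.
  rewrite -!EFinM; apply: (@le_trans _ _ ((`|C| + 1)%:E *
    (Lseminorm mu0 p0 (fun i => A0 (f i)) (row j M) *
      Lseminorm nu0 q0 (fun i => B0 (g i)) (row j (invmx M)^T) +
     Lseminorm mu1 p1 (fun i => A1 (f i)) (row j M) *
      Lseminorm nu1 q1 (fun i => B1 (g i)) (row j (invmx M)^T))%:E)%E).
    rewrite -EFinM lee_fin ler_wpM2r//; last by have := ler_norm C; lra.
    by rewrite addr_ge0// mulr_ge0//; [case: qA0|case: qB0|case: qA1|case: qB1].
  rewrite EFinM -muleA lee_wpmul2l ?lee_fin ?addr_ge0//.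
  by rewrite ge0_muleDr// EFinD leeD.
clearbody D.
case: (m0 + m1)%E tD (adde_ge0 m00 m10) => [m tD _|_ _|_ //]; last first.
  by rewrite gt0_muley ?lte_fin// leey.
(* Almost everywhere the sum equals the combination of the [t j] with all coefficients 1, so the
   quasi-triangle inequality in L^r applies. *)
have -> : 'N[rho]_r[(fun z => (\sum_(i < n) tau (f i) (g i) z)%R%:E)]%E =
    (Lseminorm rho r t (const_mx 1))%:E.
  rewrite LseminormE//; apply: ae_eq_Lnorm.
  - have Ltau i : tau (f i) (g i) \in Lfun rho r.
      by have [/(_ (g i))[Lf _] _] := htau; exact: Lf.
    have := measurable_lincomb hr Ltau (const_mx 1).
    congr measurable_fun; apply/funext => z.
    by apply: eq_bigr => i _; rewrite mxE mul1r.
  - exact: (measurable_lincomb hr Lt (const_mx 1)).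
  - apply: filterS (Lp_valued_bilinear_dual f g uM htau) => z ->.
    by apply: eq_bigr => j _; rewrite mxE mul1r.
have qt := quasi_seminorm_le kr (Lseminorm_quasi_seminorm hr Lt).
have := quasi_seminorm_mulmx (const_mx 1) 1%:M k1 qt.
rewrite mulmx1 -EFinM lee_fin => /le_trans; apply.
rewrite -!mulrA ler_wpM2l ?exprn_ge0 ?(le_trans ler01)//.
rewrite (le_trans (ler_sum _ (G := fun=> D * m) _))//; last first.
  by rewrite sumr_const card_ord mulr_natl.
move=> j _; rewrite mxE normr1 mul1r -lee_fin LseminormE// EFinM.
rewrite (le_trans _ (tD j))// le_eqVlt; apply/orP; left; apply/eqP.
apply: eq_Lnorm => z /=; congr EFin.
rewrite /lincomb (bigD1 j)//= !mxE eqxx mul1r big1 ?addr0// => i ij.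
by rewrite !mxE eq_sym (negbTE ij) mul0r.
Qed.
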